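(* Let $\mathbb{K}$ be a field of characteristic zero and let $S=\mathbb{K}[x_1,\dots,x_n]$. If $I\subset S$ is an artinian (homogeneous) ideal generated in degree $d$ with almost linear resolution, then $S/I$ has the weak Lefschetz property.
   Context: $S$ is standard graded. ''Generated in degree $d$'' means that $I$ is homogeneous and all its minimal generators have degree $d$. For an ideal $I$ generated in degree $d$, write $\beta_{i,j}(S/I)$ for the graded Betti numbers of $S/I$ over $S$; the minimal free resolution of $S/I$ is linear for $r$ steps if $\beta_{i,i+j}(S/I)=0$ for all $1\le i\le r$ and all $j\ge d$, and $S/I$ (or $I$) has almost linear resolution if this holds with $r=n-1$. For an artinian homogeneous ideal $I$, $S/I$ has the weak Lefschetz property (WLP) if there is a linear form $\ell\in(S/I)_1$ such that for all integers $j$ the multiplication map $\times\ell:(S/I)_j\to(S/I)_{j+1}$ has maximal rank, i.e. is injective or surjective. *)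

(* Defs.v *)
From mathcomp Require Import all_boot all_algebra.
From mathcomp Require Import mpoly.

Set Implicit Arguments.
Unset Strict Implicit.
Unset Printing Implicit Defensive.

Import GRing.Theory.
Local Open Scope ring_scope.

Section Ideals.

Variables (K : fieldType) (n : nat).
Local Notation S := {mpoly K[n]}.
Implicit Types (I J : S -> Prop).

(* Prop-valued, and the unit ideal is allowed, unlike [idealr_closed]. *)
Definition is_ideal I : Prop :=
  I 0 /\ forall a u v : S, I u -> I v -> I (a * u + v).

Definition homogeneous_ideal I : Prop :=
  forall (f : S) (e : nat), I f -> I (pihomog (@mdeg n) e f).

(* The ideals of S/I correspond to the ideals of S that contain I, so this is
   the descending chain condition on the ideals of S/I. *)
Definition artinian_quotient I : Prop :=
  forall J : nat -> S -> Prop,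
    (forall k, is_ideal (J k)) ->
    (forall k f, I f -> J k f) ->
    (forall k f, J k.+1 f -> J k f) ->
    exists N, forall k, (N <= k)%N -> forall f, J k f <-> J N f.

Definition generated_by m (g : 'I_m -> S) I : Prop :=
  forall f, I f <-> exists c : 'I_m -> S, f = \sum_(k < m) c k * g k.

(* A generating family from which no member can be removed. *)
Definition minimally_generated_by m (g : 'I_m -> S) I : Prop :=
  generated_by g I /\
  forall k, ~ exists c : 'I_m -> S, g k = \sum_(l < m | l != k) c l * g l.

Definition generated_in_degree (d : nat) I : Prop :=
  homogeneous_ideal I /\
  exists (m : nat) (g : 'I_m -> S),
    minimally_generated_by g I /\ forall k, g k \is d.-homog.

End Ideals.

Section Resolutions.

Variables (K : fieldType) (n : nat).
Local Notation S := {mpoly K[n]}.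

(* The data of a complex ... -> F_1 -> F_0 -> S/I of finitely generated graded
   free modules F_i = \bigoplus_k S(- deg i k).  Elements of F_i are row
   vectors, on which dif i : F_{i+1} -> F_i acts by v |-> v *m dif i; the map
   F_0 -> S/I sends v to the class of (v *m aug) 0 0.  Natural number degrees
   suffice: S/I lives in degrees >= 0, hence so do the modules of its minimal
   free resolution. *)
Record graded_free_complex := GradedFreeComplex {
  rk : nat -> nat;
  deg : forall i, 'I_(rk i) -> nat;
  dif : forall i, 'M[S]_(rk i.+1, rk i);
  aug : 'cV[S]_(rk 0) }.

Implicit Types (I : S -> Prop) (F : graded_free_complex).

Definition degree_preserving F : Prop :=
  (forall k, aug F k 0 \is (deg k).-homog) /\
  forall i (k : 'I_(rk F i.+1)) (l : 'I_(rk F i)),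
    ((deg l <= deg k)%N -> dif F i k l \is (deg k - deg l)%N.-homog) /\
    ((deg k < deg l)%N -> dif F i k l = 0).

(* Exactness of ... -> F_1 -> F_0 -> S/I -> 0 at S/I, at F_0 and at F_{i+1}. *)
Definition resolves I F : Prop :=
  [/\ forall f : S, exists v : 'rV[S]_(rk F 0), I (f - (v *m aug F) 0 0),
      forall v : 'rV[S]_(rk F 0),
        I ((v *m aug F) 0 0) <-> exists w, v = w *m dif F 0
    & forall i (v : 'rV[S]_(rk F i.+1)),
        v *m dif F i = 0 <-> exists w, v = w *m dif F i.+1].

(* The image of F_{i+1} lies in (x_1, ..., x_n) F_i. *)
Definition minimal_complex F : Prop :=
  forall i k l, (dif F i k l)@_(0%MM) = 0.

Definition minimal_graded_free_resolution I F : Prop :=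
  [/\ degree_preserving F, resolves I F & minimal_complex F].

(* b i j is the graded Betti number beta_{i,j}(S/I): the number of summands
   S(-j) of F_i.  The minimal graded free resolution F is unique up to
   isomorphism, so I determines b. *)
Definition graded_betti_numbers I (b : nat -> nat -> nat) : Prop :=
  exists2 F, minimal_graded_free_resolution I F &
    forall i j, b i j = #|[set k : 'I_(rk F i) | deg k == j]|.

Definition linear_for_steps (d r : nat) I : Prop :=
  exists2 b, graded_betti_numbers I b &
    forall i j, (1 <= i <= r)%N -> (d <= j)%N -> b i (i + j)%N = 0%N.

Definition almost_linear_resolution (d : nat) I : Prop :=
  linear_for_steps d n.-1 I.

End Resolutions.

Section WeakLefschetz.

Variables (K : fieldType) (n : nat).
Local Notation S := {mpoly K[n]}.
Implicit Types (I : S -> Prop) (l f g : S).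

(* (S/I)_j is the space of classes modulo I of the forms of degree j. *)
Definition mul_injective I l (j : nat) : Prop :=
  forall f g, f \is j.-homog -> g \is j.-homog ->
    I (l * f - l * g) -> I (f - g).

Definition mul_surjective I l (j : nat) : Prop :=
  forall g, g \is j.+1.-homog ->
    exists2 f, f \is j.-homog & I (g - l * f).

(* For negative j the map has zero source, so it is injective. *)
Definition weak_lefschetz_property I : Prop :=
  exists2 l : S, l \is 1.-homog &
    forall j : nat, mul_injective I l j \/ mul_surjective I l j.

End WeakLefschetz.

(* Main.v *)
Require Import Defs.
From mathcomp Require Import all_boot all_algebra.
From mathcomp Require Import mpoly.

(** Write x_0, ..., x_(n-1) for the variables.  A form of degree less than d
    in I is zero, so multiplication by a nonzero linear form l is injective on
    S/I as long as its target lies in degree less than d; and it is surjective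
    from degree d-1 on as soon as every form of degree at least d lies in
    I + (l) ([weak_lefschetz_of_surjective]).  The point is therefore to show
    that S/(I + (l)) vanishes in degrees at least d, here with l = x_0.

    Let F resolve S/I, and let H_k(i) be the k-th homology of F modulo
    (x_0, ..., x_(i-1)), so that H_0(1) = S/(I + (x_0)).  Reducing modulo one
    more variable x_i, which is regular on F modulo (x_0, ..., x_(i-1)), gives
    exact sequences

      H_(k+1)(i) -> H_(k+1)(i+1) -> H_k(i)(-1) --x_i--> H_k(i).

    They yield two facts.  On the one hand, an element of S that kills all the
    H_k(i) has a square that kills all the H_k(i+1) ([kills_homologyS]).  Since
    S/I is artinian, a power of each variable lies in I and kills the homology
    of F; hence each variable acts nilpotently on every H_k(i).  On the other
    hand, if H_(k+1)(i+1) vanishes in degree e+1, then x_i is injective on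
    H_k(i) in degree e ([mulX_injective_on_homology]).  If this vanishing holds
    in all degrees above e+1 as well, then injectivity and nilpotency together
    force H_k(i) to be zero in degree e.  Iterating along the diagonal
    (k, i), (k+1, i+1), ... one arrives at i = n, where F is reduced modulo all
    the variables and its homology lives in the degrees of the generators of
    F_(k+n-i).  So H_k(i) vanishes in degree e as soon as F_(k+n-i) is
    generated in degrees less than e+n-i ([homology_vanishes]).

    For k = 0 and i = 1 the relevant module is F_(n-1), the last one that the
    almost linear resolution controls: when n > 1 it is generated in degrees
    less than d+n-1, which gives the vanishing of S/(I + (x_0)) in degrees at
    least d.  If n = 1 this vanishing is clear in positive degrees.  If n = 0
    there are no nonzero forms of positive degree, and l = 0 will do. *)

Set Implicit Arguments.
Unset Strict Implicit.
Unset Printing Implicit Defensive.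

Import GRing.Theory.
Local Open Scope ring_scope.

(** * Graded parts and ideals of variables *)

Section Polynomials.

Variables (K : fieldType) (n : nat).
Local Notation S := {mpoly K[n]}.
Implicit Types (f g q : S) (m : 'X_{1..n}).

Definition restrict_monomials (P : pred 'X_{1..n}) f : S :=
  \sum_(m <- msupp f | P m) f@_m *: 'X_[m].

Lemma mcoeff_restrict P f m :
  (restrict_monomials P f)@_m = if P m then f@_m else 0.
Proof.
rewrite raddf_sum /=; under eq_bigr do rewrite mcoeffZ mcoeffX.
case Pm: (P m); last first.
  rewrite big1 // => k Pk; case: eqP => [km|_]; last by rewrite mulr0.
  by rewrite -km Pk in Pm.
case: (boolP (m \in msupp f)) => [mf|mf]; last first.
  rewrite big_seq_cond big1; last first.
    move=> k /andP[kf _]; case: eqP => [km|_]; last by rewrite mulr0.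
    by rewrite km (negPf mf) in kf.
  by apply/esym/eqP; rewrite mcoeff_eq0.
rewrite -big_filter (bigD1_seq m) /= ?mem_filter ?Pm ?filter_uniq ?msupp_uniq //.
rewrite eqxx mulr1 big1 ?addr0 // => k km.
by rewrite (negPf km) mulr0.
Qed.

(** The component of degree e of a polynomial seen as an element of S(-a); it
    is zero when e < a. *)
Definition shifted_part (a e : nat) : S -> S :=
  restrict_monomials (fun m => mdeg m + a == e)%N.

Lemma mcoeff_shifted_part a e f m :
  (shifted_part a e f)@_m = if (mdeg m + a == e)%N then f@_m else 0.
Proof. exact: mcoeff_restrict. Qed.

Lemma pihomog_shifted_part e f : pihomog (@mdeg n) e f = shifted_part 0 e f.
Proof.
rewrite /shifted_part /restrict_monomials.
by under [RHS]eq_bigl do rewrite addn0.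
Qed.

Lemma shifted_part_homogP e f :
  reflect (shifted_part 0 e f = f) (f \is e.-homog).
Proof. by rewrite homog_piE pihomog_shifted_part; apply: eqP. Qed.

Lemma shifted_part_sum a e (J : Type) (r : seq J) (P : pred J) (G : J -> S) :
  shifted_part a e (\sum_(j <- r | P j) G j)
    = \sum_(j <- r | P j) shifted_part a e (G j).
Proof.
apply/mpolyP => m; rewrite mcoeff_shifted_part !raddf_sum /=.
under [RHS]eq_bigr do rewrite mcoeff_shifted_part.
by case: ifP => // _; rewrite big1.
Qed.

Lemma shifted_partB a e f g :
  shifted_part a e (f - g) = shifted_part a e f - shifted_part a e g.
Proof.
apply/mpolyP => m; rewrite mcoeffB !mcoeff_shifted_part mcoeffB.
by case: ifP => // _; rewrite subr0.
Qed.

Lemma shifted_part_id a e f :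
  shifted_part a e (shifted_part a e f) = shifted_part a e f.
Proof. by apply/mpolyP => m; rewrite !mcoeff_shifted_part; case: eqP. Qed.

Lemma shifted_partSS a e f : shifted_part a.+1 e.+1 f = shifted_part a e f.
Proof. by apply/mpolyP => m; rewrite !mcoeff_shifted_part addnS eqSS. Qed.

(** The hypothesis says that q is an entry of a degree-preserving matrix, from
    a summand S(-a) to a summand S(-b); it covers the case a < b, where it
    forces q to be zero. *)
Lemma shifted_partM a b e f q :
    (forall m, q@_m != 0 -> (mdeg m + b = a)%N) ->
  shifted_part b e (f * q) = shifted_part a e f * q.
Proof.
move=> hq; apply/mpolyP => m; rewrite mcoeff_shifted_part !mcoeffM.
under [RHS]eq_bigr do rewrite mcoeff_shifted_part.
transitivity (\sum_(k : 'X_{1..n < (mdeg m).+1, (mdeg m).+1} | m == (k.1 + k.2)%MM)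
   if (mdeg m + b == e)%N then f@_k.1 * q@_k.2 else 0).
  by case: ifP => // _; rewrite big1.
apply: eq_bigr => k /eqP mE.
have [->|nz] := eqVneq q@_k.2 0; first by rewrite !mulr0 if_same.
rewrite -(hq _ nz) addnA -mdegD -mE.
by case: ifP; rewrite ?mul0r.
Qed.

Lemma shifted_part_mulX a e (i : 'I_n) f :
  shifted_part a e.+1 ('X_i * f) = 'X_i * shifted_part a e f.
Proof.
rewrite mulrC [RHS]mulrC -(shifted_partSS a e); apply: shifted_partM => m.
rewrite mcoeffX; case: (U_(i)%MM =P m) => [<- _|_]; last by rewrite eqxx.
by rewrite mdeg1.
Qed.

(** Membership in the ideal (x_0, ..., x_(i-1)), read off the monomials.  With
    this form, the regularity of x_i modulo that ideal and the compatibility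
    with graded parts are statements about single coefficients. *)
Definition in_first_vars (i : nat) f : Prop :=
  forall m, (forall j : 'I_n, (j < i)%N -> m j = 0%N) -> f@_m = 0.

Lemma in_first_vars0 f : in_first_vars 0 f -> f = 0.
Proof. by move=> f0; apply/mpolyP => m; rewrite mcoeff0 f0. Qed.

Lemma in_first_vars_homog e f : f \is e.+1.-homog -> in_first_vars n f.
Proof.
move=> hf m m0; apply: (dhomog_nemf_coeff hf).
have -> : m = 0%MM by apply/mnmP => j; rewrite mnm0E m0.
by rewrite /= mdeg0.
Qed.

Lemma in_first_varsM i f q : in_first_vars i f -> in_first_vars i (f * q).
Proof.
move=> hf m m0; rewrite mcoeffM big1 // => k /eqP/mnmP mE.
rewrite hf ?mul0r // => j ji.
by have /eqP := mE j; rewrite m0 // mnmDE eq_sym addn_eq0 => /andP[/eqP].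
Qed.

Lemma in_first_vars_sum i (J : Type) (r : seq J) (P : pred J) (G : J -> S) :
  (forall j, P j -> in_first_vars i (G j)) ->
  in_first_vars i (\sum_(j <- r | P j) G j).
Proof.
move=> hG m m0; rewrite raddf_sum /= big1 // => j Pj; exact: hG.
Qed.

Lemma in_first_vars_part i a e f :
  in_first_vars i f -> in_first_vars i (shifted_part a e f).
Proof. by move=> hf m m0; rewrite mcoeff_shifted_part hf ?if_same. Qed.

Lemma in_first_vars_regular (i : 'I_n) f :
  in_first_vars i ('X_i * f) -> in_first_vars i f.
Proof.
move=> hf m m0; rewrite -(mcoeffMX f U_(i)%MM m) mulrC hf // => j ji.
rewrite mnmDE m0 // addn0 mnm1E; case: eqP => // ij.
by rewrite ij ltnn in ji.
Qed.

(** The quotient in the division of f by x_i with remainder free of x_i. *)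
Definition var_quotient (i : 'I_n) f : S :=
  \sum_(m <- msupp f | (0 < m i)%N) f@_m *: 'X_[(m - U_(i))%MM].

Lemma var_quotientE i f :
  'X_i * var_quotient i f = restrict_monomials (fun m => 0 < m i)%N f.
Proof.
rewrite mulr_sumr; apply: eq_bigr => m m_i.
rewrite -scalerAr -mpolyXD addmC submK //.
by apply/mnm_lepP => j; rewrite mnm1E; case: eqP => // <-.
Qed.

Lemma in_first_varsS (i : 'I_n) f :
  in_first_vars i.+1 f -> in_first_vars i (f - 'X_i * var_quotient i f).
Proof.
move=> hf m m0; rewrite var_quotientE mcoeffB mcoeff_restrict.
case: ifPn => [_|]; first by rewrite subrr.
rewrite -eqn0Ngt subr0 => /eqP mi0; apply: hf => j; rewrite ltnS leq_eqVlt.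
by case/orP => [/eqP/val_inj -> //|]; apply: m0.
Qed.

Lemma in_first_vars_mulX (i : 'I_n) f : in_first_vars i.+1 ('X_i * f).
Proof.
rewrite mulrC => m m0; rewrite mcoeffM big1 // => k /eqP/mnmP mE.
rewrite mcoeffX; case: eqP => [ik|_]; last by rewrite mulr0.
by have := mE i; rewrite m0 // mnmDE -ik mnm1E eqxx addn1.
Qed.

End Polynomials.

(** * Row vectors *)

Section Vectors.

Variables (K : fieldType) (n : nat).
Local Notation S := {mpoly K[n]}.

Definition row_in_first_vars i r (v : 'rV[S]_r) : Prop :=
  forall l, in_first_vars i (v 0 l).

Lemma row_in_first_varsD i r (v w : 'rV[S]_r) :
  row_in_first_vars i v -> row_in_first_vars i w -> row_in_first_vars i (v + w).
Proof. by move=> hv hw l m m0; rewrite mxE mcoeffD hv // hw // addr0. Qed.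

Lemma row_in_first_vars_eq0 i r : row_in_first_vars i (0 : 'rV[S]_r).
Proof. by move=> l m m0; rewrite mxE mcoeff0. Qed.

Lemma row_in_first_varsZ i r (a : S) (v : 'rV[S]_r) :
  row_in_first_vars i v -> row_in_first_vars i (a *: v).
Proof. by move=> hv l; rewrite mxE mulrC; apply: in_first_varsM. Qed.

Lemma row_in_first_varsB i r (v w : 'rV[S]_r) :
  row_in_first_vars i v -> row_in_first_vars i w -> row_in_first_vars i (v - w).
Proof. by move=> hv hw l m m0; rewrite !mxE mcoeffB hv // hw // subr0. Qed.

Lemma row_in_first_vars_mulmx i r s (v : 'rV[S]_r) (M : 'M[S]_(r, s)) :
  row_in_first_vars i v -> row_in_first_vars i (v *m M).
Proof.
by move=> hv l; rewrite mxE; apply: in_first_vars_sum => j _; apply: in_first_varsM.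
Qed.

Lemma row_in_first_vars_widen i r (v : 'rV[S]_r) :
  row_in_first_vars i v -> row_in_first_vars i.+1 v.
Proof. by move=> hv l m m0; apply: hv => j ji; apply: m0; apply: ltnW. Qed.

Lemma row_in_first_vars_mulX (i : 'I_n) r (v : 'rV[S]_r) :
  row_in_first_vars i.+1 ('X_i *: v).
Proof. by move=> l; rewrite mxE; apply: in_first_vars_mulX. Qed.

Lemma row_in_first_vars_regular (i : 'I_n) r (v : 'rV[S]_r) :
  row_in_first_vars i ('X_i *: v) -> row_in_first_vars i v.
Proof. by move=> hv l; apply: in_first_vars_regular; have := hv l; rewrite mxE. Qed.

Lemma row_in_first_varsS (i : 'I_n) r (v : 'rV[S]_r) :
    row_in_first_vars i.+1 v ->
  exists u j, v = 'X_i *: u + j /\ row_in_first_vars i j.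
Proof.
move=> hv; pose u := map_mx (var_quotient i) v.
exists u, (v - 'X_i *: u); split; first by rewrite addrC subrK.
by move=> l; rewrite !mxE; apply: in_first_varsS.
Qed.

Definition row_part r (a : 'I_r -> nat) e (v : 'rV[S]_r) : 'rV[S]_r :=
  \row_l shifted_part (a l) e (v 0 l).

Definition row_homog r (a : 'I_r -> nat) e (v : 'rV[S]_r) : Prop :=
  row_part a e v = v.

Lemma row_part_homog r (a : 'I_r -> nat) e v : row_homog a e (row_part a e v).
Proof. by apply/rowP => l; rewrite !mxE shifted_part_id. Qed.

Lemma row_partB r (a : 'I_r -> nat) e v w :
  row_part a e (v - w) = row_part a e v - row_part a e w.
Proof. by apply/rowP => l; rewrite !mxE shifted_partB. Qed.

Lemma row_part_mulX r (a : 'I_r -> nat) e (i : 'I_n) v :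
  row_part a e.+1 ('X_i *: v) = 'X_i *: row_part a e v.
Proof. by apply/rowP => l; rewrite !mxE shifted_part_mulX. Qed.

Lemma row_part_mulmx r s (a : 'I_r -> nat) (b : 'I_s -> nat) e v
    (M : 'M[S]_(r, s)) :
    (forall k l m, (M k l)@_m != 0 -> (mdeg m + b l = a k)%N) ->
  row_part b e (v *m M) = row_part a e v *m M.
Proof.
move=> hM; apply/rowP => l; rewrite !mxE shifted_part_sum.
apply: eq_bigr => k _; rewrite mxE; apply: shifted_partM => m; exact: hM.
Qed.

Lemma row_in_first_vars_part i r (a : 'I_r -> nat) e v :
  row_in_first_vars i v -> row_in_first_vars i (row_part a e v).
Proof. by move=> hv l; rewrite mxE; apply: in_first_vars_part. Qed.

End Vectors.

(** * Homology modulo variables *)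

Section Complexes.

Variables (K : fieldType) (n : nat).
Local Notation S := {mpoly K[n]}.
Variable F : graded_free_complex K n.

(** Cycles of F modulo (x_0, ..., x_(i-1)).  The complex ends at F_0, where
    every vector is a cycle: its homology there is S/I modulo these variables.
    *)
Definition cycle_mod i k : 'rV[S]_(rk F k) -> Prop :=
  if k is k'.+1 then fun v => row_in_first_vars i (v *m dif F k')
  else fun=> True.

Definition boundary_mod i k (v : 'rV[S]_(rk F k)) : Prop :=
  exists w j, v = w *m dif F k + j /\ row_in_first_vars i j.

Definition kills_homology (P : S) i : Prop :=
  forall k (v : 'rV_(rk F k)), cycle_mod i v -> boundary_mod i (P *: v).

Hypothesis dif_dif : forall k, dif F k.+1 *m dif F k = 0.

(** H_k(i+1) is an extension of a submodule of H_(k-1)(i) by a quotient of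
    H_k(i); one factor P is spent on each of them. *)
Lemma kills_homologyS (P : S) (i : 'I_n) :
  kills_homology P i -> kills_homology (P * P) i.+1.
Proof.
move=> killP k v cv.
(* Modulo x_i, the class of P v comes from that of P v - x_i w in H_k(i). *)
suff [w vw]: exists w, cycle_mod i (P *: v - 'X_i *: w).
  have [u [j [E hj]]] := killP _ _ vw.
  exists u, (j + P *: ('X_i *: w)); split.
    by rewrite addrA -E scalerBr subrK scalerA.
  by apply: row_in_first_varsD;
    [apply: row_in_first_vars_widen|apply/row_in_first_varsZ/row_in_first_vars_mulX].
case: k v cv => [|k] v cv; first by exists 0.
(* u represents the image of v under the connecting map to H_k(i). *)
have [u [j [E hj]]] := row_in_first_varsS cv.
have cu: cycle_mod i u.
  case: k v u j E hj cv => [//|k] v u j E hj _; apply: row_in_first_vars_regular.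
  have /(congr1 (mulmx^~ (dif F k))) := E.
  rewrite -mulmxA dif_dif mulmx0 mulmxDl -scalemxAl => /esym/eqP.
  rewrite addr_eq0 => /eqP ->; rewrite -mulNmx.
  by apply: row_in_first_vars_mulmx; rewrite -sub0r;
    apply: row_in_first_varsB => //; apply: row_in_first_vars_eq0.
have [w [j' [E' hj']]] := killP _ _ cu.
exists w; rewrite /= mulmxBl -!scalemxAl E scalerDr scalerA mulrC -scalerA E'.
rewrite scalerDr addrAC [_ + _ - _]addrAC subrr add0r.
by apply: row_in_first_varsD; apply: row_in_first_varsZ.
Qed.

Lemma kills_homology_exp (P : S) i :
  (i <= n)%N -> kills_homology P 0 -> kills_homology (P ^+ (2 ^ i)) i.
Proof.
elim: i => [|i IHi] // lt_in kill0.
rewrite expnS mul2n -addnn exprD.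
exact: (@kills_homologyS _ (Ordinal lt_in) (IHi (ltnW lt_in) kill0)).
Qed.

Hypothesis dif_deg : forall k (a : 'I_(rk F k.+1)) (b : 'I_(rk F k)) m,
  (dif F k a b)@_m != 0 -> (mdeg m + deg b = deg a)%N.

(** The kernel of x_i on H_k(i) is a quotient of H_(k+1)(i+1), through the
    connecting map; it shifts degrees by one.  A vector w0 that exhibits x_i v
    as a boundary is a cycle modulo one more variable, and its homogeneous part
    w still exhibits x_i v as a boundary. *)
Lemma mulX_injective_on_homology (i : 'I_n) k e (v : 'rV_(rk F k)) :
    (forall w : 'rV_(rk F k.+1),
       row_homog (@deg _ _ F k.+1) e.+1 w -> cycle_mod i.+1 w ->
       boundary_mod i.+1 w) ->
    row_homog (@deg _ _ F k) e v ->
  boundary_mod i ('X_i *: v) -> boundary_mod i v.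
Proof.
move=> exact_next hv [w0 [j0 [E0 hj0]]].
pose w := row_part (@deg _ _ F k.+1) e.+1 w0.
pose j := row_part (@deg _ _ F k) e.+1 j0.
have hj : row_in_first_vars i j by apply: row_in_first_vars_part.
have E : 'X_i *: v = w *m dif F k + j.
  rewrite -{1}hv -row_part_mulX -(row_part_mulmx _ _ (@dif_deg k)).
  by apply/eqP; rewrite -subr_eq -row_partB {1}E0 addrK.
have cw : cycle_mod i.+1 w.
  rewrite /= (_ : _ *m _ = 'X_i *: v - j); last by rewrite E addrK.
  by apply: row_in_first_varsB;
    [apply: row_in_first_vars_mulX|apply: row_in_first_vars_widen].
have [u [j1 [Ew hj1]]] := exact_next w (row_part_homog _ _ _) cw.
have [w' [j2 [Ej hj2]]] := row_in_first_varsS hj1.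
exists w', (v - w' *m dif F k); split; first by rewrite addrC subrK.
apply: row_in_first_vars_regular.
rewrite scalerBr E Ew Ej !mulmxDl -mulmxA dif_dif mulmx0 add0r -scalemxAl.
rewrite -addrA addrC addrA subrK.
by apply: row_in_first_varsD => //; apply: row_in_first_vars_mulmx.
Qed.

(** The induction is on the number c of variables that remain.  For c = 0 a
    homogeneous vector of degree above all generators has its entries in the
    maximal ideal.  For c > 0, the induction hypothesis makes x_i injective on
    H_k(i) in degree e and above, where it is also nilpotent. *)
Lemma homology_vanishes :
    (forall i : 'I_n, exists N, kills_homology ('X_i ^+ N) 0) ->
  forall c i k e (v : 'rV_(rk F k)),
    (i + c = n)%N ->
    (forall l : 'I_(rk F (k + c)), deg l < e + c)%N ->
    row_homog (@deg _ _ F k) e v -> cycle_mod i v -> boundary_mod i v.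
Proof.
move=> nilX; elim=> [|c IHc] i k e v.
  rewrite addn0 => ->; rewrite !addn0 => degs hv _.
  exists 0, v; split; first by rewrite mul0mx add0r.
  move=> l m m0; rewrite -hv mxE mcoeff_shifted_part.
  rewrite (_ : m = 0%MM) ?mdeg0; last by apply/mnmP => j; rewrite mnm0E m0.
  by rewrite add0n; case: eqP => // E; have := degs l; rewrite E ltnn.
move=> ic_n degs hv cv.
have lt_in : (i < n)%N by rewrite -ic_n addnS ltnS leq_addr.
pose i' := Ordinal lt_in.
have desc e' (w : 'rV_(rk F k)) : (e <= e')%N ->
    row_homog (@deg _ _ F k) e' w ->
  boundary_mod i ('X_i' *: w) -> boundary_mod i w.
  move=> le_ee' hw; apply: (@mulX_injective_on_homology i' k e' w) => // u hu cu.
  apply: (IHc i.+1 k.+1 e'.+1) => //; first by rewrite addSnnS.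
  rewrite addSnnS => l; apply: leq_trans (degs l) _.
  by rewrite addSnnS leq_add2r.
have [N killX] := nilX i'.
have [] := kills_homology_exp (ltnW lt_in) killX cv.
rewrite -exprM; elim: (N * 2 ^ i)%N => [|p IHp].
  by rewrite expr0 scale1r => w [j [-> hj]]; exists w, j.
move=> w [j [E hj]].
have hp q : row_homog (@deg _ _ F k) (e + q) ('X_i' ^+ q *: v).
  elim: q => [|q IHq]; first by rewrite addn0 expr0 scale1r.
  by rewrite exprS -scalerA addnS /row_homog row_part_mulX IHq.
have [w' [j' [E' hj']]] : boundary_mod i ('X_i' ^+ p *: v).
  apply: (desc (e + p)%N) => //; first exact: leq_addr.
  by rewrite scalerA -exprS; exists w, j.
by apply: (IHp w'); exists j'.
Qed.

End Complexes.

(** * Ideals of forms *)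

Section Ideals.

Variables (K : fieldType) (n : nat) (I : {mpoly K[n]} -> Prop).
Local Notation S := {mpoly K[n]}.
Hypothesis idealI : is_ideal I.

Lemma idealD (f g : S) : I f -> I g -> I (f + g).
Proof. by move=> hf hg; have := idealI.2 1 _ _ hf hg; rewrite mul1r. Qed.

Lemma idealM (a f : S) : I f -> I (a * f).
Proof. by move=> hf; have := idealI.2 a _ _ hf idealI.1; rewrite addr0. Qed.

(** The chain I + (x_i^k) is stationary, so x_i^N = a + b x_i^(N+1) with a in
    I; comparing the parts of degree N shows that x_i^N is the part of degree N
    of a. *)
Lemma artinian_var_power (i : 'I_n) :
  homogeneous_ideal I -> artinian_quotient I -> exists N, I ('X_i ^+ N).
Proof.
move=> homI artI.
pose J k (f : S) := exists2 a, I a & exists b, f = a + b * 'X_i ^+ k.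
have [] := artI J.
- move=> k; split.
    by exists 0; [exact: idealI.1 | exists 0; rewrite mul0r addr0].
  move=> c u v [a Ia [b ->]] [a' Ia' [b' ->]].
  exists (c * a + a'); first by apply: idealD => //; apply: idealM.
  by exists (c * b + b'); rewrite mulrDr mulrDl mulrA addrACA.
- by move=> k f If; exists f => //; exists 0; rewrite mul0r addr0.
- move=> k f [a Ia [b ->]]; exists a => //.
  by exists (b * 'X_i); rewrite exprS mulrA.
move=> N stab; have [_] := stab N.+1 (leqnSn N) ('X_i ^+ N).
case=> [|a Ia [b XE]].
  by exists 0; [exact: idealI.1 | exists 1; rewrite add0r mul1r].
exists N.
suff <- : shifted_part 0 N a = 'X_i ^+ N.
  by rewrite -pihomog_shifted_part; apply: homI.
have XN k : ('X_i ^+ k : S) \is k.-homog.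
  by rewrite mpolyXn dhomogX /= mdegMn mdeg1 mul1n.
rewrite -[RHS](shifted_part_homogP _ _ (XN N)) XE; apply/mpolyP => m.
rewrite !mcoeff_shifted_part mcoeffD; case: eqP => // mN.
rewrite mcoeffM big1 ?addr0 // => k /eqP mE.
rewrite (dhomog_nemf_coeff (XN N.+1)) ?mulr0 //=.
apply/eqP => kN; move/(congr1 (@mdeg n)): mE; rewrite mdegD kN => mE.
by move: mN (leq_addl (mdeg k.1) N.+1); rewrite -mE addn0 => ->; rewrite ltnn.
Qed.

Lemma homog_below_generators d e f :
  generated_in_degree d I -> (e < d)%N -> I f -> f \is e.-homog -> f = 0.
Proof.
case=> _ [k [g [[genI _] homg]]] lt_ed /genI[c ->] /shifted_part_homogP <-.
rewrite shifted_part_sum; apply: big1 => l _; apply/mpolyP => m.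
rewrite mcoeff_shifted_part mcoeff0 addn0; case: eqP => // me.
rewrite mcoeffM big1 // => p /eqP mE.
rewrite (dhomog_nemf_coeff (homg l)) ?mulr0 //=.
apply: contraTneq lt_ed => /= pd; rewrite -leqNgt -me -pd.
by move: (leq_addl (mdeg p.1) (mdeg p.2)); rewrite -mdegD -mE.
Qed.

Lemma weak_lefschetz_of_surjective d (l : S) :
    generated_in_degree d I -> l != 0 -> l \is 1.-homog ->
    (forall e g, (d <= e.+1)%N -> g \is e.+1.-homog -> exists u, I (g - u * l)) ->
  weak_lefschetz_property I.
Proof.
move=> genI l0 l1 surj; exists l => // e; case: (leqP d e.+1) => [le_de|lt_ed].
  right=> g hg; have [u Iu] := surj _ _ le_de hg.
  exists (shifted_part 0 e u).
    by apply/shifted_part_homogP; rewrite shifted_part_id.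
  have := genI.1 _ e.+1 Iu.
  rewrite pihomog_shifted_part shifted_partB (shifted_part_homogP _ _ hg).
  rewrite (@shifted_partM _ _ 1) ?shifted_partSS 1?mulrC // => m.
  by rewrite addn0; apply: contraNeq => /(dhomog_nemf_coeff l1) ->.
left=> f g hf hg; rewrite -mulrBr => Il.
have hfg : l * (f - g) \is e.+1.-homog by rewrite -add1n dhomogM ?rpredB.
have /eqP := homog_below_generators genI lt_ed Il hfg.
by rewrite mulf_eq0 (negPf l0) => /eqP ->; exact: idealI.1.
Qed.

End Ideals.

(** * Forms modulo a variable *)

Section Surjectivity.

Variables (K : fieldType) (n : nat) (I : {mpoly K[n]} -> Prop).
Variable F : graded_free_complex K n.
Hypotheses (idealI : is_ideal I) (resF : resolves I F).

Lemma resolution_dif_dif k : dif F k.+1 *m dif F k = 0.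
Proof.
case: resF => _ _ exF; apply/row_matrixP => i; rewrite row_mul row0.
by apply/exF; exists (delta_mx 0 i); rewrite rowE.
Qed.

Lemma ideal_kills_homology P : I P -> kills_homology F P 0.
Proof.
case: resF => _ ex0 exS IP [|k] v cv.
  have [|w ->] := (ex0 (P *: v)).1.
    by rewrite -scalemxAl mxE mulrC; apply: idealM.
  by exists w, 0; split; rewrite ?addr0 //; apply: row_in_first_vars_eq0.
have [|w ->] := (exS k (P *: v)).1.
  rewrite -scalemxAl (_ : v *m _ = 0) ?scaler0 //.
  by apply/rowP => l; rewrite [RHS]mxE; apply: in_first_vars0.
by exists w, 0; split; rewrite ?addr0 //; apply: row_in_first_vars_eq0.
Qed.

Hypothesis degF : degree_preserving F.

Lemma degree_preserving_dif k (a : 'I_(rk F k.+1)) (b : 'I_(rk F k)) m :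
  (dif F k a b)@_m != 0 -> (mdeg m + deg b = deg a)%N.
Proof.
have [ge lt] := degF.2 k a b.
case: (leqP (deg b) (deg a)) => [le_ba|/lt ->]; last by rewrite mcoeff0 eqxx.
move=> nz; rewrite -[RHS](subnK le_ba); congr (_ + _)%N; apply/eqP.
by apply: contraNT nz => /(dhomog_nemf_coeff (ge le_ba)) ->.
Qed.

Lemma degree_preserving_aug (a : 'I_(rk F 0)) m :
  (aug F a 0)@_m != 0 -> mdeg m = deg a.
Proof.
move=> nz; apply/eqP.
by apply: contraNT nz => /(dhomog_nemf_coeff (degF.1 a)) ->.
Qed.

(** This is the vanishing of H_0(1) in degree e: a homogeneous lift of g to F_0
    is a boundary up to a multiple of x_0, and the augmentation sends
    boundaries into I. *)
Lemma forms_in_ideal_plus_variable (i0 : 'I_n) d e g :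
    homogeneous_ideal I -> artinian_quotient I -> i0 = 0%N :> nat ->
    (forall l : 'I_(rk F n.-1), deg l < d + n.-1)%N ->
    (d <= e)%N -> g \is e.-homog ->
  exists u, I (g - u * 'X_i0).
Proof.
move=> homI artI i00 degs le_de hg.
have [surjF ex0 _] := resF; have [v0 Iv0] := surjF g.
pose v := row_part (@deg _ _ F 0) e v0.
have Iv : I (g - (v *m aug F) 0 0).
  have := homI _ e Iv0.
  rewrite pihomog_shifted_part shifted_partB (shifted_part_homogP _ _ hg).
  rewrite -(@row_part_mulmx _ _ _ _ _ (fun=> 0%N)) ?mxE // => a b m.
  by rewrite ord1 addn0; apply: degree_preserving_aug.
have [w [j [vE hj]]] : boundary_mod 1 v.
  apply: (homology_vanishes resolution_dif_dif degree_preserving_dif _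
            (c := n.-1) (e := e)).
  - move=> i; have [N IN] := artinian_var_power idealI i homI artI.
    by exists N; apply: ideal_kills_homology.
  - by rewrite add1n prednK // (leq_ltn_trans _ (ltn_ord i0)).
  - by move=> l; apply: leq_trans (degs l) _; rewrite leq_add2r.
  - exact: row_part_homog.
  - by [].
have hj0 : row_in_first_vars i0.+1 j by rewrite i00.
have [u [j' [jE hj']]] := row_in_first_varsS hj0.
have j'0 : j' = 0.
  apply/rowP => l; rewrite [RHS]mxE; apply: in_first_vars0.
  by have := hj' l; rewrite i00.
exists ((u *m aug F) 0 0).
have Iw : I ((w *m dif F 0 *m aug F) 0 0) by apply/ex0; exists w.
have := idealD idealI Iv Iw.
suff -> : (v *m aug F) 0 0
    = (w *m dif F 0 *m aug F) 0 0 + (u *m aug F) 0 0 * 'X_i0.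
  by rewrite opprD [- _ - _]addrC addrA subrK.
rewrite vE jE j'0 addr0 mulmxDl -scalemxAl mxE [X in _ + X]mxE.
by rewrite [_ * 'X_i0]mulrC.
Qed.

End Surjectivity.

Theorem corollary2p10 (K : fieldType) (charK : [pchar K]%R =i pred0)
    (n d : nat) (I : {mpoly K[n]} -> Prop)
    (idealI : is_ideal I) (artinianI : artinian_quotient I)
    (generatedI : generated_in_degree d I)
    (linearI : almost_linear_resolution d I) :
  weak_lefschetz_property I.
Proof.
case: n => [|n] in I idealI artinianI generatedI linearI *.
  exists 0 => [|e]; first exact: dhomog0.
  right=> g hg; exists 0; first exact: dhomog0.
  rewrite mul0r subr0 (in_first_vars0 (in_first_vars_homog hg)).
  exact: idealI.1.
apply: (weak_lefschetz_of_surjective idealI (l := 'X_ord0) generatedI).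
- apply/eqP => /(congr1 (mcoeff U_(ord0)%MM)).
  by rewrite mcoeffXU mcoeff0 eqxx => /eqP; rewrite oner_eq0.
- by rewrite dhomogX /= mdeg1.
(* In one variable, x_0 divides every form of positive degree. *)
move=> e g le_de hg.
case: n => [|n] in I idealI artinianI generatedI linearI g hg *.
  have hg' := in_first_varsS (i := ord0) (in_first_vars_homog hg).
  exists (var_quotient ord0 g); rewrite mulrC (in_first_vars0 hg').
  exact: idealI.1.
case: linearI => b [F [degF resF _] bE] b0.
apply: (forms_in_ideal_plus_variable idealI resF degF generatedI.1 artinianI
          _ _ le_de hg) => //= l.
rewrite ltnNge; apply/negP => le_l.
(* Otherwise l would be counted by a Betti number that vanishes, the one with
   indices n.+1 and deg l. *)
have le_nl := leq_trans (leq_addl d n.+1) le_l.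
have := b0 n.+1 (deg l - n.+1)%N; rewrite subnKC // ltnSn leq_subRL //.
rewrite addnC le_l bE => /(_ isT isT)/cards0_eq/setP/(_ l).
by rewrite !inE eqxx.
Qed.
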